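(* Consider the Kuramoto model on the complete graph with $N\ge 2$ vertices, $$\dot\theta=\omega-\frac{K}{N}\,B\sin(B^T\theta),$$ where $B$ is an incidence matrix of the complete graph (for some orientation), $\omega\in\mathbb{R}^N$ is the vector of natural frequencies and $K>0$ is the coupling. Let $K_L$ be the critical coupling, i.e. the value of $K$ below which no fixed point exists. Then $$K_L\ \ge\ \|B^T\omega\|_\infty\,\frac{N}{2(N-1)}.$$
   Context: The complete graph on $N$ vertices has $e=N(N-1)/2$ edges; after choosing an arbitrary orientation, its incidence matrix $B$ is the $N\times e$ matrix with $B_{ij}=1$ if edge $j$ is incoming to vertex $i$, $B_{ij}=-1$ if edge $j$ is outgoing from vertex $i$, and $0$ otherwise. $\sin$ of a vector is componentwise. Fixed points are understood modulo common rotation (natural frequencies may be centered around zero): $\theta$ is a fixed point if $B\sin(B^T\theta)=\frac{N}{K}(\omega-\langle\omega\rangle\mathbf{1}_N)$, where $\langle\omega\rangle=\frac1N\sum_i\omega_i$ and $\mathbf{1}_N$ is the all-ones vector. *)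

(* Defs.v *)
From HB Require Import structures.
From mathcomp Require Import all_boot all_order all_algebra.
From mathcomp Require Import all_classical all_reals all_analysis.

Set Implicit Arguments.
Unset Strict Implicit.
Unset Printing Implicit Defensive.

Import Order.TTheory GRing.Theory Num.Theory.
Import numFieldNormedType.Exports.

Local Open Scope classical_set_scope.
Local Open Scope ring_scope.

(* Edges of the complete graph on 'I_N are indexed by 'I_(num_edges N). *)
Definition num_edges (N : nat) : nat := ((N * N.-1)./2)%N.

(* Edge k goes from src k to tgt k: no edge is a loop, and every pair of
   distinct vertices is joined by exactly one edge, in one direction. *)
Definition complete_orientation (N : nat)
    (src tgt : 'I_(num_edges N) -> 'I_N) : Prop :=
  (forall k, src k != tgt k) /\
  (forall i j : 'I_N, i != j ->
     exists! k, (src k = i /\ tgt k = j) \/ (src k = j /\ tgt k = i)).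

Definition incidence_mx (R : realType) (N e : nat) (src tgt : 'I_e -> 'I_N) :
    'M[R]_(N, e) :=
  \matrix_(i < N, j < e)
    if i == tgt j then 1 else if i == src j then -1 else 0.

Definition complete_incidence (R : realType) (N : nat)
    (B : 'M[R]_(N, num_edges N)) : Prop :=
  exists src tgt : 'I_(num_edges N) -> 'I_N,
    complete_orientation src tgt /\ B = incidence_mx R src tgt.

Definition sin_cv (R : realType) (e : nat) (v : 'cV[R]_e) : 'cV[R]_e :=
  map_mx (@sin R) v.

Definition mean_cv (R : realType) (N : nat) (w : 'cV[R]_N) : R :=
  N%:R^-1 * \sum_(i < N) w i 0.

Definition kuramoto_field (R : realType) (N e : nat) (B : 'M[R]_(N, e))
    (w : 'cV[R]_N) (K : R) (theta : 'cV[R]_N) : 'cV[R]_N :=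
  w - (K / N%:R) *: (B *m sin_cv (B^T *m theta)).

Definition is_fixed_point (R : realType) (N e : nat) (B : 'M[R]_(N, e))
    (w : 'cV[R]_N) (K : R) (theta : 'cV[R]_N) : Prop :=
  B *m sin_cv (B^T *m theta) =
  (N%:R / K) *: (w - mean_cv w *: const_mx 1).

(* Fixed points are the equilibria of the model in the frame rotating at the
   mean frequency. *)
Lemma is_fixed_pointP (R : realType) (N e : nat) (B : 'M[R]_(N, e))
    (w : 'cV[R]_N) (K : R) (theta : 'cV[R]_N) :
  (0 < N)%N -> 0 < K ->
  is_fixed_point B w K theta <->
  kuramoto_field B (w - mean_cv w *: const_mx 1) K theta = 0.
Proof.
move=> N0 K0; rewrite /is_fixed_point /kuramoto_field.
have nN : N%:R != 0 :> R by rewrite pnatr_eq0 -lt0n.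
have nK : K != 0 by rewrite gt_eqF.
split=> [->|/eqP]; first by rewrite scalerA mulrA divfK // divff // scale1r subrr.
by rewrite subr_eq0 => /eqP ->; rewrite scalerA mulrA divfK // divff // scale1r.
Qed.

(* The set below is bounded below by 0 and, for B the incidence matrix of a
   complete graph, nonempty (strong coupling locks the oscillators), so this
   is a genuine infimum: the largest value such that no positive K below it
   admits a fixed point. *)
Definition critical_coupling (R : realType) (N e : nat) (B : 'M[R]_(N, e))
    (w : 'cV[R]_N) : R :=
  inf [set K : R | 0 < K /\ exists theta : 'cV[R]_N, is_fixed_point B w K theta].

(* Main.v *)
Require Import Defs.
From HB Require Import structures.
From mathcomp Require Import all_boot all_order all_algebra.
From mathcomp Require Import all_classical all_reals all_analysis.
From mathcomp Require Import ring lra.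

Import Order.TTheory GRing.Theory Num.Theory.
Import numFieldNormedType.Exports.

Local Open Scope ring_scope.

(** At vertex [i] of the complete graph the coupling term is the sum of
    [sin (theta_i - theta_j)] over the other vertices [j], so it has absolute
    value at most [N - 1].  If [K] admits a fixed point, subtracting the
    equations at the two ends [i], [j] of an edge removes the mean frequency
    and gives [(N / K) |omega_i - omega_j| <= 2 (N - 1)], that is, the bound for
    [K] ([fixed_point_bound]).

    The critical coupling is an infimum, and the infimum of the empty set is
    [0] by convention, so the bound on each [K] transfers to it only once some
    [K] is known to admit a fixed point ([fixed_point_exists]).  Such a locked
    state is explicit: scale the centred frequencies to a vector [x] with
    entries in [-1, 1] and put [theta_i = asin x_i].  As the [x_j] sum to zero,
    the coupling term at [i] is [x_i * \sum_j cos theta_j], which is proportional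
    to the centred frequency; the factor determines [K].  *)

(** * Incidence matrices of complete graphs *)

Lemma tr_incidence_mulE {R : realType} {N e : nat} (src tgt : 'I_e -> 'I_N)
    (v : 'cV[R]_N) (k : 'I_e) : src k != tgt k ->
  ((incidence_mx R src tgt)^T *m v) k 0 = v (tgt k) 0 - v (src k) 0.
Proof.
move=> st; rewrite mxE (bigD1 (tgt k)) //= (bigD1 (src k)) //=.
rewrite !mxE eqxx (negPf st) eqxx big1 ?addr0 ?mul1r ?mulN1r // => i.
by case/andP=> it is_; rewrite !mxE (negPf it) (negPf is_) mul0r.
Qed.

(** The arbitrary signs of the orientation cancel because [g] is antisymmetric;
    the diagonal term [g i i], which corresponds to no edge, is zero for the
    same reason. *)
Lemma incidence_sum_antisym {R : realType} {N : nat}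
    {src tgt : 'I_(num_edges N) -> 'I_N} (g : 'I_N -> 'I_N -> R) (i : 'I_N) :
  complete_orientation src tgt -> (forall a b, g a b = - g b a) ->
  \sum_k incidence_mx R src tgt i k * g (tgt k) (src k) = \sum_j g i j.
Proof.
move=> [loopless joined] gN.
have g0 a : g a a = 0 by have := gN a a; lra.
pose joins k j := ((src k == i) && (tgt k == j)) || ((src k == j) && (tgt k == i)).
(* Double counting of the incident pairs (edge k, other end j). *)
transitivity (\sum_k \sum_(j | joins k j) g i j).
  apply: eq_bigr => k _; rewrite mxE /joins; have st := loopless k.
  case: (eqVneq i (tgt k)) => [ei|nit]; last case: (eqVneq i (src k)) => [ei|nis].
  - rewrite (big_pred1 (src k)) ?mul1r ?ei // => j.
    by rewrite (negPf st) /= andbT eq_sym.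
  - rewrite (big_pred1 (tgt k)) ?mulN1r ?ei -?gN // => j.
    by rewrite andbF orbF eq_sym.
  - by rewrite mul0r big1 // => j; rewrite andbF.
rewrite (exchange_big_dep predT) //=; apply: eq_bigr => j _.
case: (eqVneq i j) => [<-|ij]; first by rewrite g0 big1.
have [k0 [k0ij k0uniq]] := joined i j ij.
rewrite (big_pred1 k0) // => k /=; apply/idP/eqP => [|->].
  by move=> kij; apply/esym/k0uniq; case/orP: kij => /andP[/eqP-> /eqP->];
     [left|right].
by rewrite /joins; case: k0ij => -[-> ->]; rewrite !eqxx ?orbT.
Qed.

(** * The bound at a given coupling *)

Lemma couplingE {R : realType} {N : nat} {B : 'M[R]_(N, num_edges N)}
    (theta : 'cV[R]_N) (i : 'I_N) : complete_incidence B ->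
  (B *m sin_cv (B^T *m theta)) i 0 = \sum_j sin (theta i 0 - theta j 0).
Proof.
move=> [src [tgt [co ->]]].
rewrite -(incidence_sum_antisym (fun a b => sin (theta a 0 - theta b 0)) i co).
  rewrite mxE; apply: eq_bigr => k _; rewrite [sin_cv _ _ _]mxE.
  by rewrite (tr_incidence_mulE _ _ _ _ (co.1 k)).
by move=> a b; rewrite -sinN opprB.
Qed.

Lemma coupling_le {R : realType} {N : nat} {B : 'M[R]_(N, num_edges N)}
    (theta : 'cV[R]_N) (i : 'I_N) : complete_incidence B ->
  `|(B *m sin_cv (B^T *m theta)) i 0| <= N%:R - 1.
Proof.
move=> hB; rewrite couplingE // (bigD1 i) //= subrr sin0 add0r.
apply: le_trans (ler_norm_sum _ _ _) _.
apply: (@le_trans _ _ (\sum_(j < N | j != i) 1)).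
  by apply: ler_sum => j _; exact: sin_max.
have -> : N%:R - 1 = \sum_(j < N) 1 - 1 :> R.
  by rewrite sumr_const card_ord.
by rewrite [in leRHS](bigD1 i) //= addrAC subrr add0r.
Qed.

Lemma fixed_point_bound {R : realType} {N : nat} {B : 'M[R]_(N, num_edges N)}
    {omega theta : 'cV[R]_N} {K : R} :
  (2 <= N)%N -> complete_incidence B -> 0 < K ->
  is_fixed_point B omega K theta ->
  `|B^T *m omega| * (N%:R / (2 * (N%:R - 1))) <= K.
Proof.
move=> hN hB K0 fp.
have N2 : 2 <= N%:R :> R by rewrite ler_nat.
have diff_le a b : N%:R / K * `|omega a 0 - omega b 0| <= 2 * (N%:R - 1).
  have NK : 0 <= N%:R / K by rewrite divr_ge0 ?ler0n ?ltW.
  have -> : N%:R / K * `|omega a 0 - omega b 0| =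
      `|(B *m sin_cv (B^T *m theta)) a 0 - (B *m sin_cv (B^T *m theta)) b 0|.
    rewrite fp !mxE -mulrBr normrM (ger0_norm NK).
    by congr (_ * `|_|); lra.
  apply: le_trans (ler_normB _ _) _.
  by have := coupling_le theta a hB; have := coupling_le theta b hB; lra.
rewrite mulrA ler_pdivrMr; last by lra.
rewrite -ler_pdivlMr; last by lra.
rewrite /Num.norm /= mx_normrE; apply: bigmax_le => [|[k z] _ /=].
  by apply: divr_ge0; [apply: mulr_ge0|]; lra.
have [src [tgt [co eB]]] := hB.
rewrite ord1 eB (tr_incidence_mulE _ _ _ _ (co.1 k)) ler_pdivlMr; last by lra.
have := diff_le (tgt k) (src k); rewrite mulrAC ler_pdivrMr // => h.
by rewrite mulrC [K * _]mulrC.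
Qed.

(** * Existence of a locked state *)

Lemma sum_sub_mean {R : realType} {N : nat} (w : 'cV[R]_N) : (0 < N)%N ->
  \sum_i (w - mean_cv w *: const_mx 1) i 0 = 0.
Proof.
move=> N0; rewrite (eq_bigr (fun i => w i 0 - mean_cv w)); last first.
  by move=> i _; rewrite !mxE mulr1.
rewrite sumrB sumr_const card_ord /mean_cv -[_ *+ N]mulr_natl mulVKf ?subrr //.
by rewrite pnatr_eq0 -lt0n.
Qed.

(** In the addition formula for [sin (theta_i - theta_j)] the terms with
    [sin theta_j = x j] sum to zero; what is left is [x i] times a factor
    independent of [i], so the coupling term is parallel to [x]. *)
Lemma sum_sin_asin {R : realType} {N : nat} (x : 'I_N -> R) (i : 'I_N) :
  (forall j, -1 <= x j <= 1) -> \sum_j x j = 0 ->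
  \sum_j sin (asin (x i) - asin (x j)) = x i * \sum_j cos (asin (x j)).
Proof.
move=> x1 x0.
have sx j : sin (asin (x j)) = x j by rewrite asinK // in_itv /= x1.
under eq_bigr do rewrite sinB !sx.
by rewrite sumrB -!mulr_sumr x0 mulr0 subr0.
Qed.

Lemma fixed_point_exists {R : realType} {N : nat}
    {B : 'M[R]_(N, num_edges N)} (omega : 'cV[R]_N) :
  (2 <= N)%N -> complete_incidence B ->
  exists K, 0 < K /\ exists theta, is_fixed_point B omega K theta.
Proof.
move=> hN hB; have N0 : (0 < N)%N by apply: leq_trans hN.
set v := omega - mean_cv omega *: const_mx 1.
(* The summand 1 keeps the scaled frequencies off the ends of [-1, 1], so that
   all the cosines below are positive. *)
pose s := 1 + \sum_i `|v i 0|.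
have s0 : 0 < s by rewrite ltr_pwDl // sumr_ge0.
pose x i := v i 0 / s.
have x1 i : -1 < x i < 1.
  rewrite -ltr_norml normrM [`|s^-1|]gtr0_norm ?invr_gt0 // ltr_pdivrMr // mul1r.
  by rewrite /s (bigD1 i) //= addrCA ltrDl ltr_pwDl // sumr_ge0.
have x1W i : -1 <= x i <= 1 by case/andP: (x1 i) => ? ?; rewrite !ltW.
pose S := \sum_i cos (asin (x i)).
have S0 : 0 < S.
  have c0 i : 0 < cos (asin (x i)).
    rewrite cos_asin // sqrtr_gt0 subr_gt0 -[x i ^+ 2]real_normK ?num_real //.
    by rewrite expr_lt1 // ltr_norml.
  rewrite /S (bigD1 (Ordinal N0)) //= ltr_pwDl ?c0 //.
  by apply: sumr_ge0 => i _; exact/ltW.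
have N0R : 0 < N%:R :> R by rewrite ltr0n.
exists (N%:R * s / S); split; first by rewrite divr_gt0 ?mulr_gt0.
exists (\col_i asin (x i)); apply/matrixP => i z; rewrite ord1.
rewrite couplingE // -/v.
under eq_bigr do rewrite !mxE.
rewrite sum_sin_asin // -/S; first by rewrite /x [RHS]mxE; field; rewrite !gt_eqF.
by rewrite -mulr_suml sum_sub_mean ?mul0r.
Qed.

(* On column vectors `|v| is the sup norm (mx_norm). *)
Theorem mainTheorem3 (R : realType) (N : nat) (hN : (2 <= N)%N)
    (B : 'M[R]_(N, num_edges N)) (hB : complete_incidence B)
    (omega : 'cV[R]_N) :
  critical_coupling B omega >=
    `|B^T *m omega| * (N%:R / (2 * (N%:R - 1))).
Proof.
apply: lb_le_inf => [|K [K0 [theta fp]]]; first exact: fixed_point_exists.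
exact: fixed_point_bound fp.
Qed.
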